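(* Let $\mathbb{F}_q$ be a finite field, let $a\in\mathbb{F}_q$ be a non-square in $\mathbb{F}_q$, let $b\in\mathbb{F}_{q^2}\setminus\mathbb{F}_q$ satisfy $b^2=a$, and let $n$ be a positive integer such that $\operatorname{rad}(n+1)$ divides $q-1$. Then for every irreducible factor $f(x)$ of $E_n(x,a)$ in $\mathbb{F}_q[x]$ there exist $\alpha\in\mathbb{F}_{q^2}^*$ and a positive divisor $t$ of $2(n+1)$ satisfying (i) $\alpha^{2(n+1)/t}=1$, (ii) $\operatorname{rad}(t)$ divides $\operatorname{ord}_{q^2}(\alpha)$, (iii) $\gcd\left(t,\frac{q^2-1}{\operatorname{ord}_{q^2}(\alpha)}\right)=1$, (iv) $(\alpha,t)\notin\{(1,1),(-1,1)\}$, such that $f(x)$ has the following form: (a) $f(x)=D_t(x,a)-b^t(\alpha+\alpha^{-1})$ in the case that either $t$ is even and ($\alpha\in\mathbb{F}_q^*$ or $\alpha^{q+1}=1$), or $t$ is odd and ($\alpha^{q-1}=-1$ or $\alpha^{q+1}=-1$); (b) $f(x)=\left(D_t(x,a)-b^t(\alpha+\alpha^{-1})\right)\left(D_t(x,a)-b^{qt}(\alpha^q+\alpha^{-q})\right)$ in the case that $\alpha$ and $t$ satisfy neither of the conditions in (a).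
   Context: For $n\ge 1$ and $a\in\mathbb{F}_q$, the $n$-th Dickson polynomials of the first and second kind with parameter $a$ are $D_n(x,a)=\sum_{i=0}^{\lfloor n/2\rfloor}\frac{n}{n-i}\binom{n-i}{i}(-a)^i x^{n-2i}$ and $E_n(x,a)=\sum_{i=0}^{\lfloor n/2\rfloor}\binom{n-i}{i}(-a)^i x^{n-2i}$ in $\mathbb{F}_q[x]$ (the numbers $\frac{n}{n-i}\binom{n-i}{i}$ are integers, viewed in $\mathbb{F}_q$). $\operatorname{rad}(n)$ is the product of the distinct primes dividing $n$, with $\operatorname{rad}(1)=1$. $\operatorname{ord}_{q^2}(\alpha)$ is the multiplicative order of $\alpha$ in the cyclic group $\mathbb{F}_{q^2}^*$. Irreducible factors are normalized to be monic. (The existence of a non-square forces $q$ to be odd.) *)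

(* Defs.v *)
From HB Require Import structures.
From mathcomp Require Import all_boot all_order all_fingroup all_algebra.

Set Implicit Arguments.
Unset Strict Implicit.
Unset Printing Implicit Defensive.

Import GRing.Theory.
Local Open Scope ring_scope.

Definition radn (n : nat) : nat := (\prod_(p <- primes n) p)%N.

(* The division in [dicksonD] is exact. *)
Lemma dicksonD_coef_dvd (n i : nat) :
  (0 < n)%N -> (i <= n./2)%N -> ((n - i) %| n * 'C(n - i, i))%N.
Proof.
move=> n_gt0 le_i.
have lein : (i <= n)%N by apply: leq_trans le_i _; rewrite -divn2 leq_div.
have -> : (n * 'C(n - i, i) = (n - i) * 'C(n - i, i) + i * 'C(n - i, i))%N.
  by rewrite -mulnDl subnK.
rewrite (dvdn_addr _ (dvdn_mulr _ (dvdnn _))).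
case: i lein {le_i} => [|i] lein; first by rewrite mul0n dvdn0.
case Dm: (n - i.+1)%N => [|m]; first by rewrite bin0n muln0 dvdn0.
by rewrite -mul_bin_diag dvdn_mulr.
Qed.

(* Intended for n >= 1: this gives dicksonD 0 a = 0, not the usual 2. *)
Definition dicksonD (R : comNzRingType) (n : nat) (a : R) : {poly R} :=
  \sum_(i < n./2.+1)
    (((n * 'C(n - i, i)) %/ (n - i))%:R * (- a) ^+ i) *: 'X^(n - 2 * i).

Definition dicksonE (R : comNzRingType) (n : nat) (a : R) : {poly R} :=
  \sum_(i < n./2.+1) ('C(n - i, i)%:R * (- a) ^+ i) *: 'X^(n - 2 * i).

(* F is F_q, and iota embeds it in L = F_(q^2). *)
Definition single_factor_case (F L : finFieldType) (iota : {rmorphism F -> L})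
    (alpha : {unit L}) (t : nat) : Prop :=
  (~~ odd t /\ ((exists c : F, iota c = val alpha) \/
                val alpha ^+ (#|F| + 1) = 1))
  \/
  (odd t /\ (val alpha ^+ (#|F| - 1) = - 1 \/ val alpha ^+ (#|F| + 1) = - 1)).

(* Main.v *)
Require Import Defs.
From HB Require Import structures.
From mathcomp Require Import all_boot all_order all_fingroup all_algebra.
From mathcomp Require Import all_solvable all_field.
From mathcomp Require Import zify ring.

(* Write q = #|F|, Q = q^2.  In an algebraic closure of L a root x of f is
   x = b (z + 1/z), and E_n (x, a) = 0 forces z^(2(n+1)) = 1 with z <> 1, -1.
   If d is the order of z, take t = d / gcd(d, Q - 1) and alpha = z^t, which
   has order gcd(d, Q - 1) and so lies in L.  Then D_t (x, a) equals
   c = b^t (alpha + 1/alpha).  Since the primes dividing d divide q - 1, lifting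
   the exponent shows that d divides Q^k - 1 only when t divides k, and d never
   divides Q^k + 1; hence x has degree t over L and D_t - c is its minimal
   polynomial there.  Finally b^q = -b, so the single-factor case is exactly
   c^q = c; otherwise x has degree 2t over F and f = (D_t - c) (D_t - c^q). *)

Set Implicit Arguments.
Unset Strict Implicit.
Unset Printing Implicit Defensive.

Import GRing.Theory.
Local Open Scope ring_scope.

(** * Lifting the exponent, and the divisors of Q^k - 1 and Q^k + 1 *)

Lemma dvdn_sub_expn (m n k : nat) : (m - n %| m ^ k - n ^ k)%N.
Proof. by rewrite subn_exp dvdn_mulr. Qed.

(** With u = 1 + w r, u^i is 1 + i w r modulo r^2, so the sum is r + C(r, 2) w r modulo r^2. An odd
    r divides C(r, 2); for r = 2 the sum is 1 + u, which is 2 modulo 4. *)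
Lemma logn_geom_sum_prime (r u : nat) :
  prime r -> (0 < u)%N -> (r %| u - 1)%N -> (r = 2 -> 4 %| u - 1)%N ->
  logn r (\sum_(i < r) u ^ i) = 1%N.
Proof.
move=> r_pr u_gt0 /dvdnP[w Ew] r2.
have Eu : u = (1 + w * r)%N by lia.
have r_gt1 := prime_gt1 r_pr.
have powE (i : nat) : exists m, (u ^ i = 1 + i * (w * r) + m * r ^ 2)%N.
  elim: i => [|i [m IH]]; first by exists 0%N; rewrite expn0.
  exists (i * w ^ 2 + m * u)%N; rewrite expnS IH {1}Eu [in RHS]Eu; ring.
have sumE k : exists m, (\sum_(i < k) u ^ i = k + 'C(k, 2) * (w * r) + m * r ^ 2)%N.
  elim: k => [|k [m IH]]; first by exists 0%N; rewrite big_ord0.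
  have [m' Em'] := powE k.
  by exists (m + m')%N; rewrite big_ord_recr /= IH Em' binS bin1; ring.
have [m Em] := sumE r.
have [s Es] : exists s, (\sum_(i < r) u ^ i = r * (1 + s * r))%N.
  case: (eqVneq r 2%N) => [Er|r_neq2].
    have /dvdnP[v Ev] := r2 Er.
    exists v; rewrite Er big_ord_recl big_ord1 /= expn0 expn1; lia.
  have /dvdnP[v Ev] : (r %| 'C(r, 2))%N by rewrite prime_dvd_bin //; lia.
  by exists (v * w + m)%N; rewrite Em Ev; ring.
rewrite Es lognM //; try lia.
rewrite (logn_prime r r_pr) eqxx logn_coprime //.
by rewrite /coprime addnC gcdnMDl gcdn1.
Qed.

(** Induction on k, removing one factor r at a time: each removal costs one, by the previous lemma
    for u = Q^m. Once r does not divide k, the geometric sum is k modulo r, hence prime to r. *)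
Lemma logn_expn_sub1 (r Q k : nat) :
  prime r -> (1 < Q)%N -> (r %| Q - 1)%N -> (r = 2 -> 4 %| Q - 1)%N ->
  (0 < k)%N ->
  logn r (Q ^ k - 1) = (logn r (Q - 1) + logn r k)%N.
Proof.
move=> r_pr Q_gt1 rQ r2.
have r_gt1 := prime_gt1 r_pr.
elim/ltn_ind: k => k IH k_gt0.
have geomE x j : (x ^ j - 1 = (x - 1) * \sum_(i < j) x ^ i)%N.
  by rewrite !subn1 predn_exp.
have sum_gt0 x j : (0 < j)%N -> (0 < \sum_(i < j) x ^ i)%N.
  by case: j => // j _; rewrite big_ord_recl.
have [/dvdnP[m Ek]|rNk] := boolP (r %| k)%N; last first.
  rewrite geomE lognM ?sum_gt0 //; last lia.
  congr addn; rewrite [RHS]logn_coprime ?prime_coprime //.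
  apply: logn_coprime; rewrite prime_coprime //; apply: contra rNk.
  rewrite /dvdn -modn_summ (eq_bigr (fun=> 1%N)) => [|i _].
    by rewrite sum1_card card_ord.
  have /eqP : (Q ^ i == 1 %[mod r])%N.
    rewrite eqn_mod_dvd ?expn_gt0; last lia.
    by rewrite -[1%N](exp1n i) (dvdn_trans rQ) // dvdn_sub_expn.
  by rewrite [(1 %% r)%N]modn_small.
have m_gt0 : (0 < m)%N by lia.
have Qm_gt1 : (1 < Q ^ m)%N by rewrite -(exp1n m) ltn_exp2r.
have dQm : (Q - 1 %| Q ^ m - 1)%N.
  by rewrite -[X in (_ %| _ - X)%N](exp1n m) dvdn_sub_expn.
rewrite Ek expnM geomE !lognM ?sum_gt0 //; try lia.
rewrite IH //; last nia.
rewrite logn_geom_sum_prime //; try lia.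
- by rewrite (logn_prime r r_pr) eqxx addnA.
- exact: dvdn_trans dQm.
Qed.

(** Lifting the exponent at each prime of d shows that d divides (Q - 1) k. After division by the
    gcd, the cofactors of d and Q - 1 are coprime. *)
Lemma dvdn_expn_sub1 (d Q k : nat) :
  (1 < Q)%N -> (forall r, prime r -> (r %| d)%N -> (r %| Q - 1)%N) ->
  ((2 %| d)%N -> (4 %| Q - 1)%N) -> (0 < k)%N ->
  (d %| Q ^ k - 1)%N -> (d %/ gcdn d (Q - 1) %| k)%N.
Proof.
move=> Q_gt1 radd d2 k_gt0 dvd_d.
have Qk_gt1 : (1 < Q ^ k)%N by rewrite -(exp1n k) ltn_exp2r.
have d_gt0 : (0 < d)%N by case: d dvd_d {radd d2} => //; rewrite dvd0n; lia.
have dk : (d %| (Q - 1) * k)%N.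
  apply/dvdn_partP => // r; rewrite mem_primes => /and3P[r_pr _ rd].
  rewrite p_part pfactor_dvdn //; last by rewrite muln_gt0 k_gt0 andbT; lia.
  rewrite lognM //; last lia.
  rewrite -logn_expn_sub1 //; [|exact: radd|by move=> Er; apply: d2; rewrite -Er].
  by rewrite dvdn_leq_log //; lia.
set g := gcdn _ _.
have g_gt0 : (0 < g)%N by rewrite gcdn_gt0 d_gt0.
have cop : coprime (d %/ g) ((Q - 1) %/ g).
  rewrite /coprime -(eqn_pmul2r g_gt0) muln_gcdl mul1n.
  by rewrite !divnK ?dvdn_gcdl ?dvdn_gcdr.
rewrite -(Gauss_dvdr _ cop) -(dvdn_pmul2r g_gt0) divnK ?dvdn_gcdl //.
by rewrite mulnAC divnK ?dvdn_gcdr.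
Qed.

(** A common divisor of d and Q - 1 divides Q^k + 1 and Q^k - 1, hence 2. So 2 is the only possible
    prime of d, and 4 cannot divide d. *)
Lemma dvdn_expn_add1 (d Q k : nat) :
  (1 < Q)%N -> (forall r, prime r -> (r %| d)%N -> (r %| Q - 1)%N) ->
  ((2 %| d)%N -> (4 %| Q - 1)%N) -> (d %| Q ^ k + 1)%N -> (d %| 2)%N.
Proof.
move=> Q_gt1 radd d2 dvd_d.
have Qk_gt0 : (0 < Q ^ k)%N by rewrite expn_gt0; lia.
have dvd2 m : (m %| d)%N -> (m %| Q - 1)%N -> (m %| 2)%N.
  move=> md mQ.
  have mQk : (m %| Q ^ k - 1)%N.
    by rewrite (dvdn_trans mQ) // -[X in (_ %| _ - X)%N](exp1n k) dvdn_sub_expn.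
  have -> : 2%N = (Q ^ k + 1 - (Q ^ k - 1))%N.
    by rewrite subnBA // -addnA addKn.
  by rewrite dvdn_sub // (dvdn_trans md).
have d_gt0 : (0 < d)%N by case: d dvd_d {radd d2 dvd2} => //; rewrite dvd0n; lia.
apply/dvdn_partP => // r; rewrite mem_primes => /and3P[r_pr _ rd].
have Er : r = 2%N.
  by apply/eqP; rewrite -dvdn_prime2 // dvd2 ?radd.
rewrite p_part pfactor_dvdn // {}Er in rd *.
rewrite (@logn_prime 2 2) //= leqNgt; apply/negP => lt1.
have d4 : (4 %| d)%N by rewrite (@pfactor_dvdn 2 2).
by have := dvd2 4%N d4 (d2 rd).
Qed.

(** * Dickson polynomials: recurrences and values at u + v with parameter u v *)

Section DicksonEval.
Variable R : comNzRingType.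

(** For i > n/2 one has n - i < i, so the added binomials vanish. Longer ranges let sums for
    different n be compared term by term. *)
Lemma dicksonE_widen (N n : nat) (a : R) : (n./2 < N)%N ->
  dicksonE n a =
    \sum_(i < N) ('C(n - i, i)%:R * (- a) ^+ i) *: 'X^(n - 2 * i).
Proof.
move=> ltN.
pose term i : {poly R} := ('C(n - i, i)%:R * (- a) ^+ i) *: 'X^(n - 2 * i).
rewrite /dicksonE (big_ord_widen N term) // /term.
rewrite big_mkcond /=; apply: eq_bigr => i _; case: ifP => // /negbT Hi.
by rewrite bin_small ?mul0r ?scale0r //; lia.
Qed.

Lemma dicksonE0 (a : R) : dicksonE 0 a = 1.
Proof. by rewrite /dicksonE big_ord_recl big_ord0 addr0 mulr1 scale1r. Qed.

Lemma dicksonE1 (a : R) : dicksonE 1 a = 'X.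
Proof. by rewrite /dicksonE big_ord_recl big_ord0 addr0 mulr1 scale1r. Qed.

Lemma dicksonE_rec (n : nat) (a : R) :
  dicksonE n.+2 a = 'X * dicksonE n.+1 a - a%:P * dicksonE n a.
Proof.
rewrite (@dicksonE_widen n.+3 n.+2) ?(@dicksonE_widen n.+3 n.+1); try lia.
rewrite (@dicksonE_widen n.+2 n); last lia.
rewrite big_ord_recl [X in 'X * X]big_ord_recl mulrDr !mulr_sumr -addrA -sumrN.
rewrite -big_split /=; congr +%R.
  by rewrite !bin0 !expr0 !mulr1 !scale1r !muln0 !subn0 -exprS.
apply: eq_bigr => i _; rewrite /bump leq0n !add1n !(subSS (nat_of_ord i)).
have lei : (i <= n.+1)%N by rewrite -ltnS.
(* At this padding index truncated subtraction breaks n + 1 - i = (n - i) + 1, but all three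
   binomials vanish. Elsewhere Pascal's rule applies. *)
have [Ei|neq] := eqVneq (i : nat) n.+1.
  rewrite Ei !bin_small; try lia.
  by rewrite !mul0r !scale0r !mulr0 subr0.
have -> : (n.+1 - i = (n - i).+1)%N by lia.
rewrite binS natrD mulrDl scalerDl; congr +%R.
  have [lt|ge] := ltnP (n - i) i.+1.
    by rewrite bin_small // !mul0r !scale0r mulr0.
  rewrite -scalerAr -exprS; congr (_ *: 'X^_); lia.
rewrite exprS mulrCA -mul_polyC; have -> : (n.+2 - 2 * i.+1 = n - 2 * i)%N by lia.
by rewrite -mul_polyC !polyCM polyCN; ring.
Qed.

Lemma dicksonD_rec (n : nat) (a : R) :
  dicksonD n.+2 a = dicksonE n.+2 a - a%:P * dicksonE n a.
Proof.
rewrite (@dicksonE_widen n./2.+2 n.+2) ?(@dicksonE_widen n./2.+1 n); try lia.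
rewrite /dicksonD big_ord_recl [X in _ = X - _]big_ord_recl -addrA; congr +%R.
  by rewrite bin0 muln1 subn0 divnn.
rewrite mulr_sumr -sumrN -big_split /=; apply: eq_bigr => i _.
rewrite /bump leq0n !add1n !(subSS (nat_of_ord i)).
have [m Em] : {m | (n.+1 - i = m.+1)%N} by exists (n - i)%N; have := ltn_ord i; lia.
rewrite !Em (_ : n - i = m)%N; last lia.
(* The quotient splits because (i + 1) C(m + 1, i + 1) = (m + 1) C(m, i). *)
have -> : ((n.+2 * 'C(m.+1, i.+1)) %/ m.+1 = 'C(m.+1, i.+1) + 'C(m, i))%N.
  have -> : (n.+2 = m.+1 + i.+1)%N by have := ltn_ord i; lia.
  by rewrite mulnDl -mul_bin_diag -mulnDr mulKn.
rewrite natrD mulrDl scalerDl; congr +%R.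
have -> : (n.+2 - 2 * i.+1 = n - 2 * i)%N by lia.
by rewrite exprS -!mul_polyC !polyCM polyCN; ring.
Qed.

(** The value of E_n here is the complete homogeneous sum of the u^i v^(n - i). Exchanging u and v
    gives a second relation, and the two together yield the closed form. *)
Lemma dicksonE_horner_step (n : nat) (u v : R) :
  (dicksonE n.+1 (u * v)).[u + v] =
    u * (dicksonE n (u * v)).[u + v] + v ^+ n.+1.
Proof.
elim: n => [|n IH]; first by rewrite dicksonE1 dicksonE0 hornerX hornerC mulr1.
by rewrite dicksonE_rec !hornerE IH [v ^+ n.+2]exprS; ring.
Qed.

Lemma dicksonE_horner (n : nat) (u v : R) :
  (u - v) * (dicksonE n (u * v)).[u + v] = u ^+ n.+1 - v ^+ n.+1.
Proof.
have E2 := dicksonE_horner_step n v u.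
rewrite [v + u]addrC [v * u]mulrC dicksonE_horner_step in E2.
by apply/eqP; rewrite mulrBl subr_eq addrAC eq_sym subr_eq E2 addrC.
Qed.

(** The case u = v, where the previous identity reads 0 = 0; it serves to exclude z = 1 and z =
    -1. *)
Lemma dicksonE_horner_double (n : nat) (u : R) :
  (dicksonE n (u ^+ 2)).[u + u] = n.+1%:R * u ^+ n.
Proof.
elim: n => [|n IH]; first by rewrite dicksonE0 hornerC mulr1.
rewrite expr2 dicksonE_horner_step -expr2 IH [u ^+ n.+1]exprS -[in RHS]addn1 natrD; ring.
Qed.

(** Waring's formula. It fails at t = 0, where [dicksonD] is 0 and not 2. *)
Lemma dicksonD_horner (t : nat) (u v : R) : (0 < t)%N ->
  (dicksonD t (u * v)).[u + v] = u ^+ t + v ^+ t.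
Proof.
case: t => [//|[|t]] _.
  by rewrite /dicksonD big_ord_recl big_ord0 addr0 mulr1 scale1r hornerX !expr1.
rewrite dicksonD_rec !hornerE dicksonE_horner_step.
have -> : u ^+ t.+2 = u * ((dicksonE t.+1 (u * v)).[u + v] -
                           v * (dicksonE t (u * v)).[u + v]).
  have := dicksonE_horner_step t v u; rewrite addrC [v * u]mulrC => ->.
  by rewrite addrAC subrr add0r exprS.
ring.
Qed.

Lemma size_dicksonD_sub_lead (t : nat) (a : R) : (0 < t)%N ->
  (size (dicksonD t a - 'X^t)%R <= t)%N.
Proof.
move=> t_gt0; rewrite /dicksonD big_ord_recl bin0 muln1 subn0 divnn t_gt0.
rewrite expr0 mulr1 scale1r addrAC subrr add0r.
apply: (leq_trans (size_sum _ _ _)); apply/bigmax_leqP => i _.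
apply: leq_trans (size_scale_leq _ _) _; rewrite size_polyXn ?lift0.
have := ltn_ord i; rewrite /bump; lia.
Qed.

End DicksonEval.

Lemma map_dicksonE (R S : comNzRingType) (phi : {rmorphism R -> S}) n a :
  map_poly phi (dicksonE n a) = dicksonE n (phi a).
Proof.
rewrite rmorph_sum; apply: eq_bigr => i _ /=.
by rewrite map_polyZ map_polyXn rmorphM rmorph_nat rmorphXn rmorphN.
Qed.

Lemma map_dicksonD (R S : comNzRingType) (phi : {rmorphism R -> S}) n a :
  map_poly phi (dicksonD n a) = dicksonD n (phi a).
Proof.
rewrite rmorph_sum; apply: eq_bigr => i _ /=.
by rewrite map_polyZ map_polyXn rmorphM rmorph_nat rmorphXn rmorphN.
Qed.

(** * Radicals, and finite fields embedded in larger fields *)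

Lemma radn_dvdn (m n : nat) :
  (forall r, prime r -> (r %| m)%N -> (r %| n)%N) -> (radn m %| n)%N.
Proof.
move=> dvd_n; rewrite /radn.
have : all (fun r => prime r && (r %| n)%N) (primes m).
  by apply/allP => r; rewrite mem_primes => /and3P[r_pr _ rm]; rewrite r_pr dvd_n.
elim: (primes m) (primes_uniq m) => [|r s IH] /=; first by rewrite big_nil dvd1n.
move=> /andP[rNs s_uniq] /andP[/andP[r_pr rn] s_all]; rewrite big_cons.
rewrite Gauss_dvd ?rn ?IH // big_seq; apply: (big_ind (coprime r)).
- exact: coprimen1.
- by move=> x y cx cy; rewrite coprimeMr cx cy.
move=> x xs; have /andP[x_pr _] := allP s_all x xs.
by rewrite prime_coprime // dvdn_prime2 //; apply: contraNneq rNs => ->.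
Qed.

Lemma prime_dvdn_radn (r m : nat) :
  (0 < m)%N -> prime r -> (r %| m)%N -> (r %| radn m)%N.
Proof.
move=> m_gt0 r_pr rm; rewrite /radn (big_rem r) /= ?dvdn_mulr //.
by rewrite mem_primes r_pr m_gt0.
Qed.

(** X^q - X is the product of the X - c over c in F; map it to K and evaluate at x. This is the
    membership test for both F and L. *)
Lemma finField_image_fixed (F : finFieldType) (K : fieldType)
    (phi : {rmorphism F -> K}) (x : K) :
  (exists c, phi c = x) <-> x ^+ #|F| = x.
Proof.
split=> [[c <-]|x_fix]; first by rewrite -rmorphXn expf_card.
have := congr1 (fun p => (map_poly phi p).[x]) (finField_genPoly F).
rewrite /= rmorphB /= map_polyXn map_polyX hornerD hornerN hornerXn hornerX x_fix subrr.
rewrite rmorph_prod horner_prod => /esym/eqP/prodf_eq0[c _].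
rewrite rmorphB /= map_polyX map_polyC hornerXsubC subr_eq0 => /eqP ->.
by exists c.
Qed.

Lemma pchar_nat_card (F : finFieldType) (K : fieldType)
    (phi : {rmorphism F -> K}) : [pchar K].-nat #|F|.
Proof.
have /is_abelemP[p p_pr /and3P[pF _ _]] := finField_is_abelem F.
rewrite /pgroup cardsT in pF.
have [k Ek] := p_natP pF.
have charF := card_finPcharP Ek p_pr.
by rewrite (eq_pnat _ (fmorph_pchar phi)) (eq_pnat _ (pcharf_eq charF)).
Qed.

(** If the characteristic divided m, it would divide both q - 1 and q. *)
Lemma natr_neq0_radn_dvdn (F : finFieldType) (K : fieldType)
    (phi : {rmorphism F -> K}) (m : nat) :
  (0 < m)%N -> (radn m %| #|F| - 1)%N -> m%:R != 0 :> K.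
Proof.
move=> m_gt0 rad_m; have [p p_pr charF] := finPcharP F.
rewrite -(rmorph_nat phi) fmorph_eq0 -(dvdn_pcharf charF).
apply/negP => pm; have p_q1 := dvdn_trans (prime_dvdn_radn m_gt0 p_pr pm) rad_m.
have q_gt1 := finNzRing_gt1 F.
have : (p %| #|F|)%N.
  have /is_abelemP[r r_pr /and3P[rF _ _]] := finField_is_abelem F.
  rewrite /pgroup cardsT in rF.
  have [k Ek] := p_natP rF.
  have := card_finPcharP Ek r_pr; rewrite (pcharf_eq charF) inE => /eqP Er.
  by rewrite Ek Er dvdn_exp //; case: k Ek q_gt1 => // ->.
rewrite -(@subnK 1 #|F|); last exact: ltnW q_gt1.
by rewrite dvdn_addr // dvdn1 => /eqP p1; rewrite p1 in p_pr.
Qed.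

Lemma irreducible_monic_eq (F K : fieldType) (phi : {rmorphism F -> K})
    (x : K) (f g : {poly F}) :
  f \is monic -> irreducible_poly f -> g \is monic ->
  root (map_poly phi f) x -> root (map_poly phi g) x ->
  (size g <= size f)%N -> f = g.
Proof.
move=> f_mon f_irr g_mon fx gx size_gf; apply/eqP; rewrite -eqp_monic //.
have fg : f %| g.
  apply: contraTT gx; rewrite -irreducible_poly_coprime // -(coprimep_map phi).
  by move/coprimep_root; apply.
by rewrite -dvdp_size_eqp // eqn_leq size_gf dvdp_leq ?monic_neq0.
Qed.

(** Both sides express the vanishing of (w - z)(w z - 1) = w z (w + 1/w - z - 1/z). *)
Lemma addf_inv_eq (K : fieldType) (w z : K) : w != 0 -> z != 0 ->
  (w + w^-1 == z + z^-1) = (w == z) || (w * z == 1).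
Proof.
move=> w0 z0; rewrite -subr_eq0 -[w == z]subr_eq0 -[_ * _ == 1]subr_eq0 -mulf_eq0.
have -> : (w - z) * (w * z - 1) = w * z * (w + w^-1 - (z + z^-1)).
  by field; rewrite z0 w0.
by rewrite [RHS]mulf_eq0 mulf_eq0 (negPf w0) (negPf z0).
Qed.

(** * Frobenius orbits and lower bounds for degrees *)

Section Frobenius.
Variables (F K : fieldType) (phi : {rmorphism F -> K}) (q : nat).
Hypothesis q_pchar : [pchar K].-nat q.
Hypothesis phi_fix : forall c, phi c ^+ q = phi c.

Let q_gt0 : (0 < q)%N. Proof. by case/andP: q_pchar. Qed.

Lemma horner_map_expn (p : {poly F}) (x : K) (k : nat) :
  (map_poly phi p).[x ^+ (q ^ k)] = (map_poly phi p).[x] ^+ (q ^ k).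
Proof.
have qk_pchar : [pchar K].-nat (q ^ k)%N by rewrite pnatX q_pchar.
have fixk c : phi c ^+ (q ^ k) = phi c.
  by elim: k {qk_pchar} => [|k IH]; rewrite ?expr1 // expnS exprM phi_fix.
elim/poly_ind: p => [|p c IH].
  by rewrite rmorph0 !horner0 expr0n eqn0Ngt expn_gt0 q_gt0.
rewrite rmorphD rmorphM /= map_polyX map_polyC !hornerE IH.
by rewrite exprDn_pchar // exprMn fixk.
Qed.

(* The first N iterates of Frobenius on x are distinct roots of f. *)
Lemma frobenius_orbit_size (f : {poly F}) (x : K) (N : nat) :
  f != 0 -> root (map_poly phi f) x ->
  (forall k, (0 < k < N)%N -> x ^+ (q ^ k) != x) -> (N < size f)%N.
Proof.
move=> f0 fx x_orbit; rewrite -(size_map_poly phi).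
have qk_pchar k : [pchar K].-nat (q ^ k)%N by rewrite pnatX q_pchar.
have neq i j : (i < j < N)%N -> x ^+ (q ^ i) != x ^+ (q ^ j).
  move=> /andP[ij jN]; have /x_orbit : (0 < j - i < N)%N by lia.
  (* The map y -> y^(q^i) is injective, so a coincidence at i < j gives one at 0 and j - i. *)
  apply: contraNN; rewrite -[in (q ^ j)%N](subnK (ltnW ij)) expnD exprM.
  rewrite eq_sym -subr_eq0 -exprNn_pchar // -exprDn_pchar // expf_eq0 => /andP[_].
  by rewrite subr_eq0.
pose s := [seq x ^+ (q ^ k) | k <- iota 0 N].
have <- : size s = N by rewrite size_map size_iota.
apply: max_poly_roots; first by rewrite map_poly_eq0.
- apply/allP => _ /mapP[k _ ->].
  by rewrite rootE horner_map_expn (rootP fx) expr0n eqn0Ngt expn_gt0 q_gt0.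
rewrite map_inj_in_uniq ?iota_uniq // => i j; rewrite !mem_iota !add0n /= => iN jN.
move/eqP; case: (ltngtP i j) => // ij; last rewrite eq_sym.
  by rewrite (negPf (neq _ _ _)) ?ij.
by rewrite (negPf (neq _ _ _)) ?ij.
Qed.

End Frobenius.

(** * Roots of E_n, the single-factor condition, and conjugates of a root *)

(** Take u = beta z and v = beta/z, so u v = beta^2. The closed form gives u^(n+1) = v^(n+1), and u
    = v would make the value (n + 1) u^n, which is nonzero. *)
Lemma dicksonE_root_torsion (K : closedFieldType) (n : nat) (beta x : K) :
  n.+1%:R != 0 :> K -> beta != 0 -> root (dicksonE n (beta ^+ 2)) x ->
  exists z, [/\ z != 0, x = beta * z + beta / z, z ^+ (2 * n.+1) = 1 & z ^+ 2 != 1].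
Proof.
move=> n1 beta0 Ex.
(* z solves z^2 = (x/beta) z - 1, that is, x = beta (z + 1/z). *)
have [z Ez] := @solve_monicpoly K 2 (fun i => if i == 0%N then -1 else x / beta) isT.
rewrite !big_ord_recl big_ord0 /= mulr1 addr0 expr1 in Ez.
have z0 : z != 0.
  apply: contra_eq_neq Ez => ->; rewrite expr0n mulr0 addr0 eq_sym oppr_eq0.
  exact: oner_neq0.
have xE : x = beta * z + beta / z.
  have -> : x = x / beta * z * beta / z by field; rewrite z0 beta0.
  have -> : x / beta * z = z ^+ 2 + 1 by rewrite Ez addrAC addNr add0r.
  by field.
have uv : beta ^+ 2 = (beta * z) * (beta / z) by field.
exists z; split=> //.
- have := dicksonE_horner n (beta * z) (beta / z).
  rewrite -uv -xE (rootP Ex) mulr0 => /esym/eqP; rewrite subr_eq0 !exprMn.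
  rewrite (can_eq (mulKf (expf_neq0 _ beta0))) => /eqP Ezn.
  by rewrite mul2n -addnn exprD {1}Ezn -exprMn mulVf // expr1n.
apply/negP => /eqP z2; have zV : z^-1 = z.
  by apply: (mulfI z0); rewrite mulfV // -expr2 z2.
move/rootP: Ex; rewrite uv xE zV -expr2 dicksonE_horner_double => /eqP.
by rewrite mulf_eq0 (negPf n1) expf_eq0 mulf_eq0 (negPf beta0) (negPf z0) andbF.
Qed.

(** For even q, a = a^q is the square of a^(q/2). *)
Lemma odd_card_nonsquare (F : finFieldType) (a : F) :
  (~ exists c : F, c ^+ 2 = a) -> odd #|F|.
Proof.
move=> nsq; apply: contraT => q_even; case: nsq; exists (a ^+ #|F|./2).
by rewrite -exprM muln2 halfK (negPf q_even) subn0 expf_card.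
Qed.

Lemma sqrt_nonsquare_expn_card (F : finFieldType) (L : fieldType)
    (iota : {rmorphism F -> L}) (a : F) (b : L) :
  (~ exists c : F, iota c = b) -> b ^+ 2 = iota a -> b ^+ #|F| = - b.
Proof.
move=> bNF b2; have : (b ^+ #|F|) ^+ 2 == b ^+ 2.
  by rewrite -exprM mulnC exprM b2 -rmorphXn expf_card.
by rewrite eqf_sqr => /orP[] /eqP // /finField_image_fixed /bNF.
Qed.

(** Since b^q = -b, c^q = b^t (w + 1/w) with w = (-1)^t alpha^q. So c^q = c exactly when w = alpha
    or w alpha = 1; the parity of t turns these into the four listed alternatives. *)
Lemma single_factor_caseE (F L : finFieldType) (iota : {rmorphism F -> L})
    (b : L) (alpha : {unit L}) (t : nat) :
  b != 0 -> b ^+ #|F| = - b ->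
  let c := b ^+ t * (val alpha + (val alpha)^-1) in
  single_factor_case iota alpha t <-> c ^+ #|F| = c.
Proof.
move=> b0 bq; have q_gt1 := finNzRing_gt1 F.
set x := val alpha; set q := #|F| in q_gt1 bq *.
have x0 : x != 0 by rewrite -unitfE (valP alpha).
have xq0 : x ^+ q != 0 by rewrite expf_neq0.
pose w := (-1) ^+ odd t * x ^+ q.
have s0 : (-1 : L) ^+ odd t != 0 by rewrite signr_eq0.
have w0 : w != 0 by rewrite mulf_neq0.
have cq : (b ^+ t * (x + x^-1)) ^+ q = b ^+ t * (w + w^-1).
  rewrite exprMn exprDn_pchar ?(pchar_nat_card iota) // exprAC bq exprNn -signr_odd.
  by rewrite exprVn /w invfM invr_sign; ring.
have eqc :
    (b ^+ t * (x + x^-1)) ^+ q = b ^+ t * (x + x^-1) <-> (w == x) || (w * x == 1).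
  rewrite cq -addf_inv_eq //; split=> [/(mulfI (expf_neq0 t b0)) -> //|/eqP -> //].
have xqS : x ^+ (q + 1) = x ^+ q * x by rewrite addn1 exprSr.
have xqB : x ^+ q = x ^+ (q - 1) * x by rewrite -exprSr; congr (_ ^+ _); lia.
move=> c; rewrite {}/c.
suff E : single_factor_case iota alpha t <-> (w == x) || (w * x == 1) by tauto.
rewrite /single_factor_case -/x -/q /w (finField_image_fixed iota x) -/q xqS.
case: (odd t); rewrite ?expr1 ?expr0 ?mulN1r ?mul1r ?mulNr.
  rewrite !eqr_oppLR xqB -[X in _ == - X]mul1r -mulNr (inj_eq (mulIf x0)) -xqB.
  split=> [[[]//|[_ [] ->]]|/orP[] /eqP H]; rewrite ?eqxx ?orbT //.
    by right; split=> //; left.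
  by right; split=> //; right.
split=> [[[_ [] ->]|[]//]|/orP[] /eqP H]; rewrite ?eqxx ?orbT //.
  by left; split=> //; left.
by left; split=> //; right.
Qed.

(** As beta is fixed, equality would force z^(Q^k - 1) = 1 or z^(Q^k + 1) = 1. The first contradicts
    the bound on k, the second gives z^2 = 1. *)
Lemma frobenius_iter_neq (K : fieldType) (Q d : nat) (beta z x : K) (k : nat) :
  [pchar K].-nat Q -> (1 < Q)%N -> beta != 0 -> beta ^+ Q = beta ->
  d.-primitive_root z -> z != 0 -> z ^+ 2 != 1 -> x = beta * z + beta / z ->
  (forall r, prime r -> (r %| d)%N -> (r %| Q - 1)%N) ->
  ((2 %| d)%N -> (4 %| Q - 1)%N) ->
  (0 < k < d %/ gcdn d (Q - 1))%N -> x ^+ (Q ^ k) != x.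
Proof.
move=> Q_pchar Q_gt1 beta0 beta_fix prim_z z0 z2 xE radd d2 /andP[k_gt0 lt_k].
have Qk_pchar : [pchar K].-nat (Q ^ k)%N by rewrite pnatX Q_pchar.
have betak : beta ^+ (Q ^ k) = beta.
  by elim: k {k_gt0 lt_k Qk_pchar} => [|k IH]; rewrite ?expr1 // expnS exprM beta_fix.
rewrite xE exprDn_pchar // !exprMn exprVn betak -!mulrDr (inj_eq (mulfI beta0)).
rewrite addf_inv_eq ?expf_neq0 // negb_or -[X in _ && (X != 1)]exprSr -addn1.
have QkE : (Q ^ k = Q ^ k - 1 + 1)%N by rewrite subnK // expn_gt0; lia.
apply/andP; split.
  rewrite QkE addn1 exprSr -[X in _ != X]mul1r (inj_eq (mulIf z0)).
  rewrite -(prim_order_dvd prim_z); apply/negP => /(dvdn_expn_sub1 Q_gt1 radd d2 k_gt0).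
  by move/(dvdn_leq k_gt0); rewrite leqNgt lt_k.
rewrite -(prim_order_dvd prim_z); apply/negP => /(dvdn_expn_add1 Q_gt1 radd d2).
by rewrite (prim_order_dvd prim_z) (negPf z2).
Qed.

(** * The shape of the irreducible factors of E_n over F *)

Theorem theorem4p4 (F L : finFieldType) (iota : {rmorphism F -> L})
    (cardL : #|L| = (#|F| ^ 2)%N)
    (a : F) (a_nonsquare : ~ exists c : F, c ^+ 2 = a)
    (b : L) (b_notin_F : ~ exists c : F, iota c = b) (b_sqr : b ^+ 2 = iota a)
    (n : nat) (n_gt0 : (0 < n)%N) (rad_dvd : (radn (n + 1) %| #|F| - 1)%N)
    (f : {poly F}) (f_monic : f \is monic) (f_irr : irreducible_poly f)
    (f_dvd : f %| dicksonE n a) :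
  exists (alpha : {unit L}) (t : nat),
    [/\ (0 < t)%N /\ (t %| 2 * (n + 1))%N,
        val alpha ^+ ((2 * (n + 1)) %/ t) = 1,
        (radn t %| #[alpha]%g)%N /\
          gcdn t ((#|F| ^ 2 - 1) %/ #[alpha]%g) = 1%N,
        ~ ((val alpha = 1 /\ t = 1%N) \/ (val alpha = - 1 /\ t = 1%N))
      & (single_factor_case iota alpha t ->
           map_poly iota f =
             map_poly iota (dicksonD t a)
               - (b ^+ t * (val alpha + (val alpha)^-1))%:P) /\
        (~ single_factor_case iota alpha t ->
           map_poly iota f =
             (map_poly iota (dicksonD t a)
                - (b ^+ t * (val alpha + (val alpha)^-1))%:P) *
             (map_poly iota (dicksonD t a)
                - (b ^+ (#|F| * t) *
                   (val alpha ^+ #|F| + val alpha ^- #|F|))%:P))].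
Proof.
have q_gt1 := finNzRing_gt1 F; have q_odd := odd_card_nonsquare a_nonsquare.
have bq := sqrt_nonsquare_expn_card b_notin_F b_sqr.
have b0 : b != 0 by apply/eqP => E; apply: b_notin_F; exists 0; rewrite rmorph0.
rewrite addn1 in rad_dvd *.
have [K [j _]] := countable_algebraic_closure L.
pose phi : {rmorphism F -> K} := GRing.RMorphism.clone F K (j \o iota) _.
have map_phi p : map_poly phi p = map_poly j (map_poly iota p).
  by rewrite -map_poly_comp.
have beta0 : j b != 0 by rewrite fmorph_eq0.
have beta2 : j b ^+ 2 = phi a by rewrite -rmorphXn b_sqr.
have f_size := f_irr.1; have f0 : f != 0 by rewrite monic_neq0.
have [x fx] : exists x, root (map_poly phi f) x.
  by apply/closed_rootP; rewrite size_map_poly neq_ltn f_size orbT.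
have Ex : root (dicksonE n (j b ^+ 2)) x.
  rewrite beta2 -map_dicksonE; move: fx; rewrite !root_factor_theorem => fx.
  by rewrite (dvdp_trans fx) // dvdp_map.
have n1 : n.+1%:R != 0 :> K := natr_neq0_radn_dvdn phi (ltn0Sn n) rad_dvd.
have [z [z0 xE zn z2]] := dicksonE_root_torsion n1 beta0 Ex.
have [d prim_z d_dvd] := prim_order_exists (isT : 0 < 2 * n.+1)%N zn.
have d_gt0 := prim_order_gt0 prim_z.
set q := #|F| in q_gt1 q_odd bq cardL rad_dvd *.
pose Q := (q ^ 2)%N.
have QE : (Q - 1 = (q - 1) * (q + 1))%N by rewrite /Q -[1%N](exp1n 2) subn_sqr.
have Q_gt1 : (1 < Q)%N by rewrite /Q -{1}(exp1n 2) ltn_exp2r.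
have q1_even : (2 %| q - 1)%N by rewrite dvdn2 oddB ?q_odd // ltnW.
(* Both q - 1 and q + 1 are even; this is what lifting the exponent requires at the prime 2. *)
have Q4 : (4 %| Q - 1)%N by rewrite QE (@dvdn_mul 2 2) // dvdn2 oddD q_odd.
have radd r : prime r -> (r %| d)%N -> (r %| Q - 1)%N.
  move=> r_pr rd; rewrite QE dvdn_mulr //.
  have := dvdn_trans rd d_dvd; rewrite Euclid_dvdM // => /orP[|rn].
    by rewrite dvdn_prime2 // => /eqP ->.
  exact: dvdn_trans (prime_dvdn_radn (ltn0Sn n) r_pr rn) rad_dvd.
set g := gcdn d (Q - 1); pose t := (d %/ g)%N.
have g_gt0 : (0 < g)%N by rewrite gcdn_gt0 d_gt0.
have gd : (g %| d)%N by apply: dvdn_gcdl.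
have t_gt0 : (0 < t)%N by rewrite divn_gt0 // dvdn_leq.
have td : (t %| d)%N by rewrite -(divnK gd) dvdn_mulr.
have prim_zt : g.-primitive_root (z ^+ t) by apply: dvdn_prim_root.
have q_pchar : [pchar K].-nat q by apply: pchar_nat_card phi.
have Q_pchar : [pchar K].-nat Q by rewrite pnatX q_pchar.
have jQ c : j c ^+ Q = j c by rewrite -rmorphXn /Q -cardL expf_card.
(* z^t has order g, which divides Q - 1, so it is fixed by the Q-th power and comes from L. *)
have [y yE] : exists y, j y = z ^+ t.
  apply/finField_image_fixed; rewrite cardL -/Q.
  have -> : Q = (Q - 1).+1 by rewrite subn1 prednK // ltnW.
  rewrite exprSr; have /eqP -> : (z ^+ t) ^+ (Q - 1) == 1.
    by rewrite -(prim_order_dvd prim_zt) dvdn_gcdr.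
  by rewrite mul1r.
have y0 : y != 0 by rewrite -(fmorph_eq0 j) yE expf_neq0.
pose alpha : {unit L} := finField_unit y0.
have alphaE : val alpha = y by [].
have ord_alpha : #[alpha]%g = g.
  have dvdE m : (#[alpha]%g %| m)%N = (g %| m)%N.
    rewrite order_dvdn -val_eqE FinRing.val_unitX /= -(fmorph_eq1 j) rmorphXn /= yE.
    by rewrite (prim_order_dvd prim_zt).
  by apply/eqP; rewrite eqn_dvd dvdE dvdnn -dvdE dvdnn.
exists alpha, t; rewrite alphaE ord_alpha.
pose c := b ^+ t * (y + y^-1).
(* Waring's formula with u = b z and v = b/z, as u v = a. *)
have xD : (map_poly phi (dicksonD t a)).[x] = j c.
  have ab : phi a = (j b * z) * (j b / z) by rewrite -beta2; field.
  rewrite map_dicksonD ab xE dicksonD_horner // !exprMn -yE exprVn -yE.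
  by rewrite /c rmorphM rmorphD fmorphV rmorphXn mulrDr.
have phi_q e : phi e ^+ q = phi e by rewrite -rmorphXn expf_card.
have cQ : (c ^+ q) ^+ q = c.
  by rewrite -exprM -[(q * q)%N]/(q ^ 2)%N -cardL expf_card.
have orbQ k : (0 < k < t)%N -> x ^+ (Q ^ k) != x.
  exact: (frobenius_iter_neq Q_pchar Q_gt1 beta0 (jQ b) prim_z z0 z2 xE
    radd (fun=> Q4)).
have M_mon (e : L) : map_poly iota (dicksonD t a) - e%:P \is monic /\
    size (map_poly iota (dicksonD t a) - e%:P) = t.+1.
  set r := dicksonD t (iota a) - 'X^t - e%:P.
  have -> : map_poly iota (dicksonD t a) - e%:P = 'X^t + r.
    by rewrite map_dicksonD /r; ring.
  have r_size : (size r < size ('X^t : {poly L}))%N.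
    rewrite size_polyXn ltnS (leq_trans (size_polyD _ _)) // geq_max.
    by rewrite size_dicksonD_sub_lead // size_polyN (leq_trans (size_polyC_leq1 _)).
  by rewrite monicE lead_coefDl // lead_coefXn eqxx size_polyDl // size_polyXn.
(* Both cases reduce to this: M descends to F, vanishes at x and has degree at most that of f. *)
have descend (P : {poly F}) (M : {poly L}) : map_poly iota P = M ->
    M \is monic -> (size M <= size f)%N -> root (map_poly phi P) x ->
    map_poly iota f = M.
  move=> <-; rewrite map_monic size_map_poly => P_mon P_size Px.
  by rewrite (irreducible_monic_eq f_monic f_irr P_mon fx Px).
have single := single_factor_caseE iota alpha t b0 bq; rewrite /= -/c in single.
split.
- by split; rewrite // (dvdn_trans td).
- apply/(fmorph_inj j); rewrite rmorphXn rmorph1 /= yE -exprM mulnC divnK //.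
  by rewrite (dvdn_trans td).
- split.
    apply: radn_dvdn => r r_pr rt; have rd := dvdn_trans rt td.
    by rewrite dvdn_gcd rd radd.
  (* Multiplying by g turns the claim into gcd(d, Q - 1) = g. *)
  apply/eqP; rewrite -(eqn_pmul2r g_gt0) muln_gcdl mul1n -/Q.
  by rewrite !divnK // dvdn_gcdr.
(* For t = 1, alpha is z itself, and z^2 differs from 1. *)
- have yz : t = 1%N -> j y = z by move=> t1; rewrite yE t1 expr1.
  case=> -[yV /yz jy]; move: z2;
    by rewrite -jy yV ?rmorphN rmorph1 ?sqrrN expr1n eqxx.
split=> [/single cq|/single cNq].
  have [c' c'E] : exists c', iota c' = c by apply/finField_image_fixed.
  have [M_monic M_size] := M_mon c.
  apply: (descend (dicksonD t a - c'%:P)) => //.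
  - by rewrite rmorphB /= map_polyC /= c'E.
  (* The t distinct iterates of x under the Q-th power bound the degree of f below by t. *)
  - rewrite M_size (@frobenius_orbit_size _ _ phi Q _ _ f x) // => e.
    by rewrite /Q expnS expn1 exprM !phi_q.
  by rewrite rmorphB /= map_polyC rootE hornerD hornerN hornerC xD /= c'E subrr.
have cqE : b ^+ (q * t) * (y ^+ q + y ^- q) = c ^+ q.
  rewrite /c exprMn exprDn_pchar ?(pchar_nat_card iota) // exprVn.
  by rewrite -!exprM [(t * q)%N]mulnC.
rewrite cqE -/c.
have L_pchar : [pchar L].-nat q by apply: pchar_nat_card iota.
(* s and m are the trace and norm of c over F, so the product of the two factors descends to D_t^2 -
   s D_t + m. *)
have [s sE] : exists s, iota s = c + c ^+ q.
  by apply/finField_image_fixed; rewrite -/q exprDn_pchar // cQ addrC.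
have [m mE] : exists m, iota m = c * c ^+ q.
  by apply/finField_image_fixed; rewrite -/q exprMn cQ mulrC.
have [M1_monic M1_size] := M_mon c; have [M2_monic M2_size] := M_mon (c ^+ q).
have PE : map_poly iota (dicksonD t a ^+ 2 - s%:P * dicksonD t a + m%:P) =
    (map_poly iota (dicksonD t a) - c%:P) *
      (map_poly iota (dicksonD t a) - (c ^+ q)%:P).
  rewrite rmorphD rmorphB rmorphXn rmorphM /= !map_polyC /= sE mE polyCD (polyCM c).
  by ring.
apply: (descend _ _ PE).
- by rewrite monicMl.
- rewrite size_monicM ?monic_neq0 // M1_size M2_size addSn /= addnS.
  (* Here 2t iterates of the q-th power must be distinct. Even k reduces to the orbit under Q. *)
  rewrite (@frobenius_orbit_size _ _ phi q _ _ f x) // => k k_lt.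
  have [k_odd|k_even] := boolP (odd k); last first.
    have -> : (q ^ k = Q ^ k./2)%N.
      by rewrite /Q -expnM mul2n halfK (negPf k_even) subn0.
    apply: orbQ; move: k_lt.
    by rewrite -{1 2}(even_halfK k_even) addnn double_gt0 ltn_double.
  (* For odd k, applying D_t to x^(q^k) = x gives c^(q^k) = c; as c lies in L, this means c^q =
     c. *)
  apply/negP => /eqP xk; apply: cNq.
  have := horner_map_expn q_pchar phi_q (dicksonD t a) x k.
  rewrite xk xD -(odd_double_half k) k_odd -mul2n expnD expnM -/Q expn1 mulnC exprM.
  have jQk i : j c ^+ (Q ^ i) = j c.
    by elim: i => [|i IH]; rewrite ?expr1 // expnS exprM jQ.
  by rewrite jQk -rmorphXn => /fmorph_inj.
rewrite map_phi PE -/phi rmorphM rootM; apply/orP; left.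
by rewrite rmorphB /= -map_phi map_polyC rootE hornerD hornerN hornerC xD subrr.
Qed.
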